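(* Let $G$ be a perfect Cayley graph on $n$ vertices with maximum degree $\Delta$, whose chromatic number $\chi(G)$ is odd and divides $n$. Then $G$ satisfies the Total Coloring Conjecture, i.e. $\chi''(G)\le\Delta+2$.
   Context: For a finite group $H$ and a subset $S\subseteq H$ with $S=S^{-1}$ and identity $\notin S$, the Cayley graph has vertex set $H$ and edges $\{g,gs\}$ for $g\in H$, $s\in S$. A graph is perfect if for every induced subgraph the chromatic number equals the clique number. A total coloring of a simple graph is an assignment of colors to vertices and edges such that adjacent vertices, adjacent edges, and an edge and its endpoints all receive different colors; $\chi''(G)$ is the minimum number of colors in a total coloring. *)

(* Defs.v *)
From HB Require Import structures.
From mathcomp Require Import all_boot all_fingroup.
Set Implicit Arguments.
Unset Strict Implicit.
Unset Printing Implicit Defensive.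

Record sgraph := SGraph {
  vertex :> finType;
  adj : rel vertex;
  adj_sym : symmetric adj;
  adj_irrefl : irreflexive adj }.

Lemma induced_sym (G : sgraph) (A : {set G}) :
  symmetric (fun x y : {x : G | x \in A} => adj (val x) (val y)).
Proof. by move=> x y; rewrite adj_sym. Qed.

Lemma induced_irrefl (G : sgraph) (A : {set G}) :
  irreflexive (fun x y : {x : G | x \in A} => adj (val x) (val y)).
Proof. by move=> x; rewrite adj_irrefl. Qed.

Definition induced (G : sgraph) (A : {set G}) : sgraph :=
  SGraph (@induced_sym G A) (@induced_irrefl G A).

Definition proper_coloring (G : sgraph) (k : nat) (c : {ffun G -> 'I_k}) :=
  [forall x : G, forall y : G, adj x y ==> (c x != c y)].

Definition colorable (G : sgraph) (k : nat) : bool :=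
  [exists c : {ffun G -> 'I_k}, proper_coloring c].

Lemma colorable_card (G : sgraph) : exists k, colorable G k.
Proof.
exists #|G|; apply/existsP; exists [ffun x => enum_rank x].
apply/forallP=> x; apply/forallP=> y; apply/implyP=> xy; rewrite !ffunE.
by rewrite (inj_eq enum_rank_inj); apply: contraTneq xy => ->; rewrite adj_irrefl.
Qed.

Definition chromatic_number (G : sgraph) : nat := ex_minn (colorable_card G).

Definition clique (G : sgraph) (A : {set G}) : bool :=
  [forall x in A, forall y in A, (x != y) ==> adj x y].

Definition clique_number (G : sgraph) : nat :=
  \max_(A : {set G} | clique A) #|A|.

Definition perfect (G : sgraph) : Prop :=
  forall A : {set G},
    chromatic_number (induced A) = clique_number (induced A).

Definition max_degree (G : sgraph) : nat :=
  \max_(x : G) #|[set y : G | adj x y]|.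

Definition edges (G : sgraph) : {set {set G}} :=
  [set [set p.1; p.2] | p in [set p : G * G | adj p.1 p.2]].

Definition edge (G : sgraph) : finType := {e : {set G} | e \in edges G}.

Definition total_coloring (G : sgraph) (k : nat)
    (cv : {ffun G -> 'I_k}) (ce : {ffun edge G -> 'I_k}) : bool :=
  [&& proper_coloring cv,
      [forall e : edge G, forall f : edge G,
         (e != f) && (val e :&: val f != set0) ==> (ce e != ce f)]
    & [forall x : G, forall e : edge G, (x \in val e) ==> (cv x != ce e)]].

Definition total_colorable (G : sgraph) (k : nat) : bool :=
  [exists cv : {ffun G -> 'I_k}, exists ce : {ffun edge G -> 'I_k},
     total_coloring cv ce].

Lemma total_colorable_card (G : sgraph) : exists k, total_colorable G k.
Proof.
exists #|{: G + edge G}|; apply/existsP.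
exists [ffun x => enum_rank (inl x)]; apply/existsP.
exists [ffun e => enum_rank (inr e)]; apply/and3P; split.
- apply/forallP=> x; apply/forallP=> y; apply/implyP=> xy; rewrite !ffunE.
  rewrite (inj_eq enum_rank_inj).
  by apply: contraTneq xy => -[->]; rewrite adj_irrefl.
- apply/forallP=> e; apply/forallP=> f; apply/implyP=> /andP[ef _].
  by rewrite !ffunE (inj_eq enum_rank_inj); apply: contraNneq ef => -[->].
- apply/forallP=> x; apply/forallP=> e; apply/implyP=> _.
  by rewrite !ffunE (inj_eq enum_rank_inj).
Qed.

Definition total_chromatic_number (G : sgraph) : nat :=
  ex_minn (total_colorable_card G).

Local Open Scope group_scope.

Definition cayley_adj (gT : finGroupType) (S : {set gT}) : rel gT :=
  fun g h => [exists s in S, h == g * s].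

Lemma cayley_sym (gT : finGroupType) (S : {set gT}) :
  S = S^-1 -> symmetric (cayley_adj S).
Proof.
move=> symS; suff H g h : cayley_adj S g h -> cayley_adj S h g.
  by move=> g h; apply/idP/idP; apply: H.
case/exists_inP=> s sS /eqP->; apply/exists_inP; exists s^-1.
  by rewrite symS inE invgK.
by rewrite mulgK.
Qed.

Lemma cayley_irrefl (gT : finGroupType) (S : {set gT}) :
  1 \notin S -> irreflexive (cayley_adj S).
Proof.
move=> S1 g; apply/exists_inP=> -[s sS]; rewrite eq_sym -{2}[g]mulg1.
by rewrite (inj_eq (mulgI g)) => /eqP s1; move: S1; rewrite -s1 sS.
Qed.

Definition cayley (gT : finGroupType) (S : {set gT})
    (symS : S = S^-1) (S1 : 1 \notin S) : sgraph :=
  SGraph (cayley_sym symS) (cayley_irrefl S1).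

(* Main.v *)
(* A perfect graph has a clique of size [k], its chromatic number, so in a Cayley
   graph no independent set exceeds [n / k] and the classes of a [k]-colouring
   are all maximum independent sets.  For a set [X] in one class, replacing the
   neighbours of [X] in another class by [X] leaves an independent set, so Hall's
   condition holds and any two classes are joined by a perfect matching.  These
   matchings carry the total [k]-colouring of [K_k] ([k] odd), and removing them
   leaves maximum degree [Delta - (k - 1)], for which Vizing's theorem uses
   [Delta - k + 2] further colours. *)

Require Import Defs.
From mathcomp Require Import zify.
From mathcomp Require Import all_boot all_fingroup.
Set Implicit Arguments.
Unset Strict Implicit.
Unset Printing Implicit Defensive.

(** * Hall's marriage theorem *)

(** Induction on the size of [A], according to whether some nonempty proper subset [X] is tight,
    that is, has at most [#|X|] neighbours. The default [y0] serves when [A] is empty. *)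
Lemma hall (T U : finType) (y0 : U) (E : T -> {set U}) (A : {set T}) :
  (forall X : {set T}, X \subset A -> #|X| <= #|\bigcup_(x in X) E x|) ->
  exists f : T -> U, {in A &, injective f} /\ {in A, forall x, f x \in E x}.
Proof.
have [n] := ubnP #|A|; elim: n => // n IHn in E A *; rewrite ltnS => leAn hallA.
have [->|[a aA]] := set_0Vmem A.
  by exists (fun=> y0); split=> x; rewrite inE.
pose N (X : {set T}) := \bigcup_(x in X) E x.
have [/existsP[X /and3P[ltXA X0 tightX]]|/existsPn loose] := boolP
  [exists X : {set T}, [&& X \proper A, X != set0 & #|N X| <= #|X|]].
  have sXA := proper_sub ltXA.
  have [|Y sYX|f [fI fE]] := IHn E X.
  - by apply: leq_trans leAn; apply: proper_card.
  - by apply: hallA; apply: subset_trans sXA.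
  (* Hall's condition survives outside [N X]: apply it to [X :|: Y] and cancel [#|X|], which is at
     least [#|N X|]. *)
  have [|Y sYAX|g [gI gE]] := IHn (fun x => E x :\: N X) (A :\: X).
  - apply: leq_trans leAn; apply: proper_card; rewrite properE subsetDl /=.
    have /set0Pn[x xX] := X0; apply/subsetPn; exists x; last by rewrite inE xX.
    exact: (subsetP sXA).
  - have [sYA dYX] : Y \subset A /\ [disjoint Y & X].
      by apply/andP; rewrite -subsetD.
    have := hallA (X :|: Y); rewrite subUset sXA sYA => /(_ isT).
    rewrite cardsU (_ : X :&: Y = set0) ?cards0 ?subn0; last first.
      by apply/eqP; rewrite setI_eq0 disjoint_sym.
    move=> le1; rewrite -(leq_add2l #|X|); apply: leq_trans le1 _.
    apply: (@leq_trans #|N X :|: \bigcup_(x in Y) (E x :\: N X)|).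
      apply: subset_leq_card; apply/bigcupsP=> x /setUP[] xXY.
        by apply: subset_trans (subsetUl _ _); apply: bigcup_sup.
      apply/subsetP=> y yE; rewrite inE; have [//|yN /=] := boolP (y \in N X).
      by apply/bigcupP; exists x; rewrite // inE yN.
    by rewrite cardsU (leq_trans (leq_subr _ _)) // leq_add2r.
  have cross x y : x \in X -> y \in A -> y \notin X -> f x != g y.
    move=> xX yA yX; have := gE y; rewrite !inE yX yA => /(_ isT)/andP[gN _].
    by apply: contraNneq gN => <-; apply/bigcupP; exists x; rewrite ?fE.
  exists (fun x => if x \in X then f x else g x); split=> [x y xA yA|x xA].
    case: ifPn => xX; case: ifPn => yX.
    - exact: fI.
    - by move/eqP; rewrite (negPf (cross _ _ xX yA yX)).
    - by move/esym/eqP; rewrite (negPf (cross _ _ yX xA xX)).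
    - by apply: gI; rewrite inE ?xX ?yX.
  case: ifPn => xX; first exact: fE.
  by have := gE x; rewrite !inE xX xA => /(_ isT)/andP[].
have [b bE] : exists b, b \in E a.
  apply/set0Pn; rewrite -card_gt0; have := hallA [set a].
  by rewrite sub1set big_set1 cards1; apply.
(* With no tight subset, every nonempty proper subset has a spare neighbour, so [b] can be given to
   [a] and deleted. *)
have [|Y sYA|g [gI gE]] := IHn (fun x => E x :\ b) (A :\ a).
- by rewrite [#|A|](cardsD1 a) aA in leAn.
- have [->|Y0] := eqVneq Y set0; first by rewrite cards0.
  have ltYA : Y \proper A by apply: sub_proper_trans sYA _; rewrite properD1.
  have := loose Y; rewrite ltYA Y0 /= -ltnNge => ltY.
  rewrite -ltnS; apply: leq_trans ltY _.
  apply: (@leq_trans #|b |: \bigcup_(x in Y) (E x :\ b)|).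
    apply: subset_leq_card; apply/bigcupsP=> x xY; apply/subsetP=> y yE.
    rewrite !inE; case: eqVneq => //= yb.
    by apply/bigcupP; exists x; rewrite // !inE yb.
  by rewrite cardsU1; case: (b \notin _).
have gb x : x \in A -> x != a -> g x != b.
  by move=> xA xa; have := gE x; rewrite !inE xa xA => /(_ isT)/andP[].
exists (fun x => if x == a then b else g x); split=> [x y xA yA|x xA].
  case: eqVneq => [->|xa]; case: eqVneq => [->|ya] //.
  - by move/esym/eqP; rewrite (negPf (gb _ yA ya)).
  - by move/eqP; rewrite (negPf (gb _ xA xa)).
  - by apply: gI; rewrite !inE ?xa ?ya.
case: eqVneq => [->//|xa].
by have := gE x; rewrite !inE xa xA => /(_ isT)/andP[].
Qed.

(** * Vizing's theorem by Kempe changes *)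

(* [a] and [b] generate a dihedral group, and since [a] fixes [x] the orbit of
   [x] is its orbit under [p = a b]; as [p^n a p^n = a], a point [p^n x] is
   fixed by [a] exactly when [p^(2n) x = x]. *)
Lemma dihedral_orbit (T : finType) (a b : T -> T) (x : T) :
    involutive a -> involutive b -> a x = x ->
  exists K : {set T}, [/\ x \in K, {in K, forall y, a y \in K},
    {in K, forall y, b y \in K} & #|[set y in K | a y == y]| <= 2].
Proof.
move=> aK bK ax; pose p y := a (b y).
have pI : injective p by move=> y z /(inv_inj aK)/(inv_inj bK).
pose K := [set y | fconnect p x y].
have ba y : a y \in K -> b y \in K.
  rewrite !inE => /connect_trans; apply; rewrite fconnect_sym //.
  by have := fconnect1 p (b y); rewrite {2}/p bK.
have aKK y : y \in K -> a y \in K.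
  rewrite inE => /iter_findex <-; elim: (findex _ _ _) => [|n IHn] /=.
    by rewrite ax inE.
  by rewrite {1}/p aK; apply: ba.
have pap n : iter n p (a (iter n p x)) = x.
  by elim: n => [|n IHn] //; rewrite iterSr /= {2}/p aK {2}/p bK.
exists K; split=> // [|y yK|]; first by rewrite inE.
  exact/ba/aKK.
pose m := fingraph.order p x.
suffices sub2 : [set y in K | a y == y] \subset [set x; iter m./2 p x].
  by apply: leq_trans (subset_leq_card sub2) _; rewrite cards2; case: eqP.
apply/subsetP=> y; rewrite !inE => /andP[pxy /eqP ay].
have lt_n := findex_max pxy; have def_y := iter_findex pxy.
move: (findex p x y) lt_n def_y => n lt_n def_y.
have := pap n; rewrite def_y ay -def_y -iterD addnn => p2n.
have small k : k < m -> iter k p x = x -> k = 0.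
  by move=> ltkm pk; rewrite -(findex_iter ltkm) pk findex0.
(* The period [m] of [x] divides [2n] and [n < m], so [n = 0] or [2n = m]: [y] is [x] or the point
   halfway round the orbit. *)
case: (ltngtP n.*2 m) => [lt2n|gt2n|<-].
- by have /eqP := small _ lt2n p2n; rewrite double_eq0 => /eqP->; rewrite eqxx.
- have lt2 : n.*2 - m < m.
    by rewrite ltn_subLR ?(ltnW gt2n) // addnn ltn_double.
  have := small _ lt2; rewrite -{1}(iter_order pI x) -iterD subnK 1?ltnW //.
  by move=> /(_ p2n)/eqP; rewrite subn_eq0 leqNgt gt2n.
- by rewrite doubleK eqxx orbT.
Qed.

(* A proper edge colouring of [e] seen as a family of involutions: [s c] sends
   a vertex to its neighbour along colour [c], and fixes it when it has none. *)
Definition edge_coloring (T C : finType) (e : rel T) (s : C -> T -> T) :=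
  [/\ forall c, involutive (s c),
      forall x y, e x y = (x != y) && [exists c, s c x == y] &
      forall c d x, s c x = s d x -> s c x != x -> c = d].

(** Closure makes [K] a union of components of the edges coloured [i] or [j]. Such an edge never
    leaves [K], so both of its ends see the same exchange of colours. *)
Lemma kempe_swap (T C : finType) (e : rel T) (s : C -> T -> T) i j
    (K : {set T}) :
    edge_coloring e s ->
    {in K, forall x, s i x \in K} -> {in K, forall x, s j x \in K} ->
  edge_coloring e (fun c x => s (if x \in K then tperm i j c else c) x).
Proof.
case=> sK sE sI iK jK; split=> [c x|x y|c d x].
- case: (boolP (x \in K)) => xK.
    case: tpermP => [->|->|/eqP ci /eqP cj].
    + by rewrite jK ?sK.
    + by rewrite iK ?sK.
    + by rewrite if_same sK.
  case: ifPn => [yK|_]; last exact: sK.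
  case: tpermP yK => [->|->|_ _ _]; last exact: sK.
    by move/iK; rewrite sK (negPf xK).
  by move/jK; rewrite sK (negPf xK).
- rewrite sE; congr (_ && _); case: (x \in K) => //.
  apply/existsP/existsP=> -[c /eqP <-]; last by exists (tperm i j c).
  by exists (tperm i j c); rewrite tpermK.
- by case: (x \in K) => /sI cd /cd // /perm_inj.
Qed.

Definition users (T C : finType) (M : {set T}) (F : T -> {set C}) i :=
  [set u in M | i \in F u].

(** Since [s i u = u] says that colour [i] is missing at [u], [F u] holds candidate colours for a
    new edge at [u], drawn from the colours [A] in play. *)
Definition free_palette (T C : finType) (s : C -> T -> T) (A : {set C})
    (M : {set T}) (F : T -> {set C}) :=
  forall u i, u \in M -> i \in F u -> i \in A /\ s i u = u.

(* If no colour is used exactly once, some colour [i] is unused and some [j] is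
   used at least three times; swapping them on the component of a user of [j]
   moves one or two users from [j] to [i]. *)
Lemma balance (T C : finType) (e : rel T) (s : C -> T -> T) (A : {set C})
    (M : {set T}) (F : T -> {set C}) :
    edge_coloring e s -> free_palette s A M F ->
    odd (\sum_(u in M) #|F u|) -> \sum_(u in M) #|F u| < #|A|.*2 ->
  exists s', exists F', exists i,
  [/\ edge_coloring e s' /\ (forall c, c \notin A -> s' c =1 s c),
      free_palette s' A M F', {in M, forall u, #|F' u| = #|F u|},
      i \in A & #|users M F' i| = 1].
Proof.
have [n] := ubnP #|[set i in A | users M F i == set0]|.
elim: n => // n IHn in s F *; rewrite ltnS => le_n col_s palF oddF ltF.
have [/exists_inP[i iA /eqP i1]|/exists_inPn no1] :=
  boolP [exists i in A, #|users M F i| == 1].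
  by exists s, F, i.
have sumE : \sum_(u in M) #|F u| = \sum_(i in A) #|users M F i|.
  transitivity (\sum_(u in M) \sum_(i in A | i \in F u) 1).
    apply: eq_bigr => u uM; rewrite sum1dep_card; apply: eq_card => i.
    by rewrite inE; case: (boolP (i \in F u)) => [/(palF u i uM)[->]|_];
      rewrite ?andbF.
  rewrite (exchange_big_dep (mem A)) => [|u i _ /andP[]//].
  apply: eq_bigr => i iA; rewrite sum1dep_card; apply: eq_card => u.
  by rewrite !inE [i \in A]iA.
have [i iA i0] : exists2 i, i \in A & users M F i = set0.
  suffices /exists_inP[i iA /eqP] : [exists i in A, users M F i == set0].
    by exists i.
  apply: contraTT ltF => /exists_inPn ne0.
  rewrite -leqNgt sumE -mul2n mulnC -sum_nat_const; apply: leq_sum => i iA.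
  by have := ne0 i iA; have := no1 i iA; rewrite -cards_eq0; case: #|_| => [|[]].
have [j jA oddj] : exists2 j, j \in A & odd #|users M F j|.
  apply/exists_inP; apply: contraTT oddF => /exists_inPn even.
  rewrite sumE; elim/big_rec: _ => // j m jA; rewrite oddD.
  by move/negPf=> ->; rewrite (negPf (even j jA)).
have j3 : 2 < #|users M F j|.
  by have := no1 j jA; case: #|_| oddj => [|[|[|]]].
have [x xj] : exists x, x \in users M F j.
  by apply/set0Pn; rewrite -card_gt0; apply: leq_trans j3.
have := xj; rewrite inE => /andP[xM xF].
have [sK sE sI] := col_s.
have [K [xK jK iK fix2]] := dihedral_orbit (sK j) (sK i) (palF _ _ xM xF).2.
pose t u c := if u \in K then tperm i j c else c.
have tI u : injective (t u) by rewrite /t => c d; case: ifP => // _ /perm_inj.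
(* Palettes are renamed along with the edges, so offered colours stay free and palette sizes do not
   change. *)
pose s' c u := s (t u c) u; pose F' u := [set c | t u c \in F u].
have tA u c : (t u c \in A) = (c \in A).
  by rewrite /t; case: ifP => // _; case: tpermP => [->|->|//]; rewrite iA jA.
have tD u c : c != i -> c != j -> t u c = c.
  by move=> ci cj; rewrite /t tpermD 1?eq_sym // if_same.
have col_s' : edge_coloring e s' by apply: kempe_swap.
have card_F' u : #|F' u| = #|F u|.
  by rewrite -(card_preimset (F u) (tI u)); apply: eq_card => c; rewrite !inE.
have eq_sum : \sum_(u in M) #|F' u| = \sum_(u in M) #|F u|.
  by apply: eq_bigr.
have palF' : free_palette s' A M F'.
  by move=> u c uM; rewrite inE => /(palF u _ uM)[]; rewrite tA.
have [|||||s2 [F2 [k [[col2 off2] pal2 card2 kA k1]]]] := IHn s' F'.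
- apply: leq_trans le_n; apply: proper_card; apply/properP; split; last first.
    exists i; rewrite inE iA ?i0 ?eqxx //=; apply/set0Pn; exists x.
    by rewrite !inE xM /t xK tpermL.
  apply/subsetP=> c; rewrite !inE => /andP[cA]; rewrite cA /=.
  have [->|ci] := eqVneq c i; first by rewrite i0.
  have [->|cj] := eqVneq c j; last first.
    apply: etrans; congr (_ == _); apply/setP=> u.
    by rewrite !inE tD.
  have [y yj yK] : exists2 y, y \in users M F j & y \notin K.
    apply/subsetPn; apply: contraL j3 => sjK; rewrite -leqNgt.
    apply: leq_trans fix2; apply: subset_leq_card; apply/subsetP=> y yj.
    have := yj; rewrite !inE (subsetP sjK _ yj) => /andP[yM yF] /=.
    exact/eqP/(palF _ _ yM yF).2.
  suffices /negPf-> : users M F' j != set0 by [].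
  apply/set0Pn; exists y; move: yj.
  by rewrite !inE /t (negPf yK).
- by [].
- by [].
- by rewrite eq_sum.
- by rewrite eq_sum.
exists s2, F2, k; split=> //; last by move=> u uM; rewrite card2.
split=> // c cA u; rewrite off2 // /s' tD //.
  by apply: contraNneq cA => ->.
by apply: contraNneq cA => ->.
Qed.

(* The induction step of Vizing's theorem in the style of Ehrenfeucht, Faber and
   Kierstead: the edges from a new vertex to [M] receive the colours [g].  At most
   one vertex [u0] offers a single free colour, all others offer two, so that the
   sum of the palette sizes is odd once [u0] lies in [M].  A colour used by a
   single [u] is given to [u] and leaves the set [A] of colours in play. *)
Lemma distinct_free_colors (T C : finType) (c0 : C) (e : rel T)
    (s : C -> T -> T) (A : {set C}) (M : {set T}) (F : T -> {set C}) (u0 : T) :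
    edge_coloring e s -> #|M| <= #|A| -> free_palette s A M F ->
    {in M, forall u, #|F u| = (u != u0).+1} ->
  exists s', exists g : T -> C,
  [/\ edge_coloring e s', forall c, c \notin A -> s' c =1 s c,
      {in M &, injective g} & {in M, forall u, g u \in A /\ s' (g u) u = u}].
Proof.
have [n] := ubnP #|M|; elim: n => // n IHn in s A M F u0 *.
rewrite ltnS => leMn col_s leMA palF cardF.
have [->|[u1 u1M]] := set_0Vmem M.
  by exists s, (fun=> c0); split=> // u; rewrite inE.
(* If [u0] is outside [M], one palette is cut to a single colour; the sizes then sum to
   [2 #|M| - 1], which is odd and below [2 #|A|]. *)
have [F1 [u2 [u2M palF1 cardF1]]] : exists F1 u2,
    [/\ u2 \in M, free_palette s A M F1 &
        {in M, forall u, #|F1 u| = (u != u2).+1}].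
  have [u0M|u0M] := boolP (u0 \in M); first by exists F, u0.
  have [c cF] : exists c, c \in F u1.
    by apply/set0Pn; rewrite -card_gt0 cardF.
  exists (fun u => if u == u1 then [set c] else F u), u1; split=> // [u d uM|u uM].
    case: eqP => [->|_]; last exact: palF.
    by rewrite inE => /eqP->; apply: palF.
  case: eqVneq => [_|_]; first by rewrite cards1.
  by rewrite cardF //; case: eqVneq uM u0M => // -> ->.
have sumF1 : (\sum_(u in M) #|F1 u|).+1 = #|M|.*2.
  rewrite (eq_bigr _ cardF1) (bigD1 u2) //= eqxx add1n.
  rewrite (eq_bigr (fun=> 2)) => [|u /andP[_ ->] //].
  rewrite sum_nat_const (cardsD1 u2 M) u2M add1n doubleS muln2; congr _.*2.+2.
  by apply: eq_card => u; rewrite !inE andbC.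
have [||s1 [F2 [i [[col1 off1] pal2 card2 iA i1]]]] :=
  balance col_s palF1.
- by rewrite -[odd _]negbK -oddS sumF1 odd_double.
- by rewrite sumF1 leq_double.
have /eqP/cards1P[u Xu] := i1.
have /setIdP[uM iF] : u \in users M F2 i by rewrite Xu set11.
(* The other palettes avoid [i], and later swaps only touch [A :\ i], so [i] remains free at [u]. *)
have [||| |s2 [g [col' off2 gI gfree]]] :=
  IHn s1 (A :\ i) (M :\ u) F2 u2 _ col1.
- by move: leMn; rewrite (cardsD1 u M) uM.
- by move: leMA; rewrite (cardsD1 u M) uM (cardsD1 i A) iA.
- move=> w c /setD1P[wu wM] cF; have [cA cw] := pal2 _ _ wM cF.
  split=> //; rewrite !inE cA andbT; apply: contraNneq wu => ci.
  by rewrite -in_set1 -Xu inE wM -ci.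
- by move=> w /setD1P[wu wM]; rewrite card2 // cardF1.
have gi w : w \in M -> w != u -> g w != i.
  by move=> wM wu; have [|/setD1P[]] := gfree w; rewrite // !inE wu.
exists s2, (fun w => if w == u then i else g w).
split=> // [c cA w|w w' wM w'M|w wM].
- by rewrite off2 ?off1 // !inE (negPf cA) andbF.
- case: eqVneq => [->|wu]; case: eqVneq => [->|w'u] //.
  + by move/esym/eqP; rewrite (negPf (gi _ w'M w'u)).
  + by move/eqP; rewrite (negPf (gi _ wM wu)).
  + by apply: gI; rewrite !inE ?wu ?w'u.
case: eqVneq => [->|wu].
  by split=> //; rewrite off2 ?(pal2 _ _ uM iF).2 // !inE eqxx.
by have [|/setD1P[_ gA] gw] := gfree w; rewrite // !inE wu.
Qed.

Lemma edge_coloring_degree (T C : finType) (e : rel T) (s : C -> T -> T) u :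
  edge_coloring e s -> #|[set c | s c u != u]| <= #|[set y | e u y]|.
Proof.
case=> _ sE sI; rewrite -(card_in_imset (f := fun c => s c u)); last first.
  by move=> c d; rewrite inE => cu _ /sI; apply.
apply: subset_leq_card; apply/subsetP=> _ /imsetP[c + ->].
by rewrite !inE sE eq_sym => -> /=; apply/existsP; exists c.
Qed.

(** Each involution [s c] is extended by exchanging [v] with the only [u] in [M] such that
    [g u = c], if there is one. *)
Lemma edge_coloring_add_vertex (T C : finType) (e : rel T) (s : C -> T -> T)
    (v : T) (M : {set T}) (g : T -> C) :
    edge_coloring e s -> (forall c, s c v = v) -> v \notin M ->
    {in M &, injective g} -> {in M, forall u, s (g u) u = u} ->
  exists s', edge_coloring
    (fun x y => [|| e x y, (x == v) && (y \in M) | (y == v) && (x \in M)])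
    (s' : C -> T -> T).
Proof.
move=> [sK sE sI] sv vM gI gfree.
pose t c x := if x == v then odflt v [pick u in M | g u == c]
              else if (x \in M) && (g x == c) then v else s c x.
(* Off the diagonal, [r c] is the graph of [t c]; its symmetry makes [t c] an involution. *)
pose r c x y := [\/ s c x = y, [/\ x = v, y \in M & g y = c]
                  | [/\ y = v, x \in M & g x = c]].
have s_v c x : s c x = v -> x = v by move=> sx; rewrite -(sK c x) sx sv.
have tP c x y : x != y -> t c x = y <-> r c x y.
  move=> xy; rewrite /t; split.
    case: eqVneq => [xv|xv].
      case: pickP => [u /andP[uM /eqP gu]|_] /= uy.
        by apply: Or32; rewrite -uy.
      by rewrite xv uy eqxx in xy.
    case: ifP => [/andP[xM /eqP gx] yv|_ sxy]; last exact: Or31.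
    by apply: Or33; split.
  case=> [sxy|[-> yM gy]|[yv xM gx]].
  - case: eqVneq => [xv|xv]; first by rewrite -sxy xv sv eqxx in xy.
    case: ifP => // /andP[xM /eqP gx].
    by rewrite -sxy -gx gfree ?eqxx in xy.
  - rewrite eqxx; case: pickP => [u /andP[uM /eqP gu]|/(_ y)] /=.
      by apply: gI; rewrite // gu.
    by rewrite yM gy eqxx.
  - by rewrite -yv (negPf xy) xM gx eqxx.
have r_sym c x y : r c x y -> r c y x.
  by case=> [<-|[-> yM gy]|[-> xM gx]]; rewrite /r ?sK;
    [apply: Or31 | apply: Or33 | apply: Or32].
exists t; split=> [c x|x y|c d x].
- have [xt|xt] := eqVneq x (t c x); first by rewrite -!xt.
  have tx : t c x != x by rewrite eq_sym.
  exact/(tP _ _ _ tx)/r_sym/(tP _ _ _ xt).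
- have [->|xy] := eqVneq x y.
    have -> : e y y = false by rewrite sE eqxx.
    by case: eqVneq => // ->; rewrite (negPf vM).
  rewrite sE xy /=; apply/idP/existsP => [|[c /eqP/(tP _ _ _ xy)]]; last first.
    case=> [<-|[-> -> _]|[-> -> _]]; rewrite ?eqxx ?orbT //.
    by apply/orP; left; apply/existsP; exists c.
  case/or3P=> [/existsP[c /eqP sxy]|/andP[/eqP xv yM]|/andP[/eqP yv xM]].
  + by exists c; apply/eqP/tP => //; apply: Or31.
  + by exists (g y); apply/eqP/tP => //; apply: Or32.
  + by exists (g x); apply/eqP/tP => //; apply: Or33.
move=> tcd; rewrite eq_sym => xt.
have := tcd; move/esym/(tP d x _ xt); have /(tP c x _ xt) := erefl (t c x).
move: (t c x) xt => y xy.
case=> [sc|[xv yM gy]|[yv xM gx]]; case=> [sd|[xv' yM' gy']|[yv' xM' gx']].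
- by apply: (sI c d x); rewrite ?sc ?sd // eq_sym.
- by rewrite -sc xv' sv eqxx in xy.
- by rewrite (s_v c x) ?sc // yv' eqxx in xy.
- by rewrite -sd xv sv eqxx in xy.
- by rewrite -gy.
- by rewrite xv yv' eqxx in xy.
- by rewrite (s_v d x) ?sd // yv eqxx in xy.
- by rewrite xv' yv eqxx in xy.
- by rewrite -gx.
Qed.

Lemma subset_of_card (T : finType) (A : {set T}) k :
  k <= #|A| -> exists2 B : {set T}, B \subset A & #|B| = k.
Proof.
move=> kA; exists [set x in take k (enum A)].
  by apply/subsetP=> x; rewrite inE => /mem_take; rewrite mem_enum.
rewrite cardsE (card_uniqP _) ?take_uniq ?enum_uniq // size_takel //.
by rewrite -cardE.
Qed.

(** Vertices are inserted one at a time. Before [v] is inserted, a neighbour of [v] has at most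
    [#|C| - 2] coloured edges, hence two free colours. *)
Lemma vizing (T C : finType) (e : rel T) :
    symmetric e -> irreflexive e -> (forall x, #|[set y | e x y]| < #|C|) ->
  exists s : C -> T -> T, edge_coloring e s.
Proof.
move=> e_sym e_irr deg.
suffices H (W : {set T}) : exists s : C -> T -> T,
    edge_coloring (fun x y => [&& x \in W, y \in W & e x y]) s.
  have [s [sK sE sI]] := H setT; exists s; split=> // x y.
  by rewrite -sE !inE.
have [n] := ubnP #|W|; elim: n W => // n IHn W; rewrite ltnS => leWn.
have [->|[v vW]] := set_0Vmem W.
  exists (fun _ x => x); split=> // [x y|c d x _]; last by rewrite eqxx.
  by rewrite !inE; case: eqP => //= xy; apply/esym/existsP=> -[_ /eqP].
pose e' x y := [&& x \in W :\ v, y \in W :\ v & e x y].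
have [|s col_s] := IHn (W :\ v); first by move: leWn; rewrite (cardsD1 v) vW.
rewrite -/e' in col_s; pose M := [set u in W | e v u].
have c0 : C by have /card_gt0P/sigW[] := leq_ltn_trans (leq0n _) (deg v).
have leMC : #|M| <= #|[set: C]|.
  rewrite cardsT; apply: leq_trans (ltnW (deg v)); apply: subset_leq_card.
  by apply/subsetP=> u; rewrite !inE => /andP[].
have free2 u : u \in M -> 2 <= #|[set c | s c u == u]|.
  rewrite inE => /andP[uW evu]; rewrite -(leq_add2l #|[set c | s c u != u]|).
  have -> : #|[set c | s c u != u]| + #|[set c | s c u == u]| = #|C|.
    rewrite -(cardC [set c | s c u != u]); congr (_ + _).
    by apply: eq_card => c; rewrite !inE negbK.
  apply: leq_trans (deg u); rewrite addn2 ltnS.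
  rewrite (cardsD1 v [set y | e u y]) inE e_sym evu add1n ltnS.
  apply: leq_trans (edge_coloring_degree u col_s) _.
  apply: subset_leq_card; apply/subsetP=> y; rewrite !inE /e' !inE.
  by case/and3P=> [_ /andP[-> _] ->].
(* The exceptional vertex is taken to be [v], which is not in [M], so every palette on [M] has two
   colours. *)
have /fin_all_exists[F FP] : forall u, exists B : {set C}, u \in M ->
    B \subset [set c | s c u == u] /\ #|B| = (u != v).+1.
  move=> u; have [/free2 u2|uM] := boolP (u \in M); last by exists set0.
  have [|B sB cardB] := @subset_of_card _ [set c | s c u == u] (u != v).+1.
    by apply: leq_trans u2; case: (u != v).
  by exists B.
have palF : free_palette s setT M F.
  move=> u c /FP[/subsetP sF _] /sF; rewrite !inE => /eqP; split=> //.
have cardF : {in M, forall u, #|F u| = (u != v).+1} by move=> u /FP[].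
have [s1 [g [col1 _ gI gfree]]] :=
  distinct_free_colors c0 col_s leMC palF cardF.
have [_ s1E _] := col1.
have s1v c : s1 c v = v.
  apply/eqP/negPn/negP => sv; have := s1E v (s1 c v).
  rewrite eq_sym sv /e' !inE eqxx /=.
  by move/esym/negbT/existsPn/(_ c); rewrite eqxx.
have vM : v \notin M by rewrite inE e_irr andbF.
have [t [tK tE tI]] :=
  edge_coloring_add_vertex col1 s1v vM gI (fun u uM => (gfree u uM).2).
exists t; split=> // x y; rewrite -tE /e' !inE.
have [->|xv] := eqVneq x v; have [->|yv] := eqVneq y v;
  rewrite ?vW ?e_irr ?andbF ?orbF //=.
by rewrite e_sym.
Qed.

Lemma vizing_edge_colors (T C : finType) (e : rel T) :
    symmetric e -> irreflexive e -> (forall x, #|[set y | e x y]| < #|C|) ->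
  exists col : T -> T -> C, (forall x y, col x y = col y x) /\
    forall x y z, e x y -> e x z -> col x y = col x z -> y = z.
Proof.
move=> e_sym e_irr deg; have [s [sK sE sI]] := vizing e_sym e_irr deg.
(* Without vertices [C] may be empty, and no default colour exists. *)
have [x0 _|noT] := pickP (@predT T); last first.
  have elim (x : T) : False by have := noT x.
  by exists (fun x => False_rect _ (elim x)); split=> x; have := elim x.
have c0 : C by have /card_gt0P/sigW[] := leq_ltn_trans (leq0n _) (deg x0).
exists (fun x y => odflt c0 [pick c | s c x == y]).
split=> [x y|x y z].
  congr odflt; apply: eq_pick => c.
  by apply/eqP/eqP=> <-; rewrite sK.
rewrite !sE => /andP[_ /existsP[c cy]] /andP[_ /existsP[d dz]].
case: pickP => [c' /eqP <-|/(_ c)]; last by rewrite cy.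
by case: pickP => [d' /eqP <- /= ->|/(_ d)]; last by rewrite dz.
Qed.

(** * Perfect matchings between colour classes *)

Definition independent (G : sgraph) (I : {set G}) :=
  {in I &, forall x y, ~~ adj x y}.

(** The last two conclusions give each vertex exactly one [m]-neighbour in every class but its
    own. *)
Lemma color_class_matching (G : sgraph) k (c : G -> 'I_k) q :
    (forall x y, adj x y -> c x != c y) ->
    (forall I : {set G}, independent I -> #|I| <= q) ->
    (forall i, #|[set x | c x == i]| = q) ->
  exists m : rel G, [/\ symmetric m, subrel m (@adj G),
    forall x i, c x != i -> exists2 y, c y = i & m x y &
    forall x y z, m x y -> m x z -> c y = c z -> y = z].
Proof.
move=> c_proper indep_le classq; pose V i := [set x | c x == i].
have /fin_all_exists[f fP] : forall p : 'I_k * 'I_k, exists f : G -> G,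
    p.1 != p.2 -> {in V p.1 &, injective f} /\
                  {in V p.1, forall x, f x \in [set y in V p.2 | adj x y]}.
  move=> [i j] /=; have [_|ij] := eqVneq i j; first by exists id.
  have [x0 _|noG] := pickP (@predT G); last by exists id; split=> x; have := noG x.
  have [|f fP] := @hall _ _ x0 (fun x => [set y in V j | adj x y]) (V i).
    move=> X sX; set N := \bigcup_(x in X) _.
    have sN : N \subset V j.
      by apply/bigcupsP=> x _; apply/subsetP=> y; rewrite inE => /andP[].
    have cX x : x \in X -> c x = i by move/(subsetP sX); rewrite inE => /eqP.
    have dXV : X :&: (V j :\: N) = set0.
      apply/setP=> x; rewrite !inE; apply/negP=> /and3P[/cX -> _].
      by rewrite (negPf ij).
    (* This reads [#|X| + q - #|N| <= q], which is Hall's condition. *)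
    have : #|X :|: (V j :\: N)| <= q.
      apply: indep_le => x y /setUP[xX|/setDP[xV xN]] /setUP[yX|/setDP[yV yN]].
      - by apply/negP=> /c_proper; rewrite !cX // eqxx.
      - apply: contra yN => xy; apply/bigcupP; exists x => //.
        by rewrite inE yV.
      - apply: contra xN => xy; apply/bigcupP; exists y => //.
        by rewrite inE xV adj_sym.
      - move: xV yV; rewrite !inE => /eqP xj /eqP yj.
        by apply/negP=> /c_proper; rewrite xj yj eqxx.
    rewrite cardsU dXV cards0 subn0 cardsD (setIidPr sN) -(classq j) -/(V j).
    by have := subset_leq_card sN; lia.
  by exists f.
have V_c x : x \in V (c x) by rewrite inE.
(* The matchings chosen for [(i, j)] and [(j, i)] need not be inverse to each other, so only the one
   with [i < j] is kept. *)
pose h x y := (c x < c y) && (f (c x, c y) x == y).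
have ltc x y : c x < c y -> c x != c y by rewrite ltn_neqAle => /andP[].
have h_adj x y : h x y -> adj x y.
  case/andP=> /ltc xy /eqP <-.
  by have := (fP (c x, c y) xy).2 x (V_c x); rewrite inE => /andP[].
exists (fun x y => h x y || h y x); split=> [x y|x y|x i|x y z].
- by rewrite orbC.
- by case/orP=> /h_adj //; rewrite adj_sym.
- move=> xi; case: (ltngtP (c x) i) => [lt_xi|lt_ix|/val_inj eq_xi].
  + have [_ /(_ x (V_c x))] := fP (c x, i) xi.
    rewrite !inE => /andP[/eqP cf _]; exists (f (c x, i) x) => //.
    by rewrite /h cf lt_xi eqxx.
  + have [|fI fV] := fP (i, c x); first by rewrite eq_sym.
    (* An injection between classes of equal size is onto, so vertices of the higher class are
       matched too. *)
    have eqV : f (i, c x) @: V i = V (c x).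
      apply/eqP; rewrite eqEcard card_in_imset // !classq leqnn andbT.
      by apply/subsetP=> _ /imsetP[y /fV + ->]; rewrite inE => /andP[].
    have := V_c x; rewrite -eqV => /imsetP[y + xy]; rewrite inE => /eqP cy.
    by exists y => //; rewrite /h cy lt_ix -xy eqxx orbT.
  + by rewrite eq_xi eqxx in xi.
move=> + + cyz; case/orP=> /andP[lt1 /eqP f1] /orP[]/andP[lt2 /eqP f2].
- by rewrite -f1 -f2 cyz.
- by move: lt1 lt2; rewrite cyz => /ltn_trans lt /lt; rewrite ltnn.
- by move: lt1 lt2; rewrite cyz => /ltn_trans lt /lt; rewrite ltnn.
have [fI _] := fP (c y, c x) (ltc _ _ lt1).
by apply: fI; [exact: V_c | rewrite inE cyz | rewrite f1 cyz f2].
Qed.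

(** * Assembling the total colouring *)

(** Allows colours from any finite type and edge colours given on ordered pairs; symmetry of [ce]
    makes the choice of ends [p e] immaterial. *)
Lemma total_chromatic_number_le (G : sgraph) (C : finType) (cv : G -> C)
    (ce : G -> G -> C) :
    (forall x y, ce x y = ce y x) ->
    (forall x y, adj x y -> cv x != cv y) ->
    (forall x y z, adj x y -> adj x z -> ce x y = ce x z -> y = z) ->
    (forall x y, adj x y -> cv x != ce x y) ->
  total_chromatic_number G <= #|C|.
Proof.
move=> ce_sym cv_proper ce_proper cve.
rewrite /total_chromatic_number; case: ex_minnP => k _; apply.
have /fin_all_exists[p pP] : forall e : edge G, exists p : G * G,
    adj p.1 p.2 /\ val e = [set p.1; p.2].
  by case=> e /= /imsetP[p]; rewrite inE => ? ->; exists p.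
have ceP (e : edge G) x y : adj x y -> x \in val e -> y \in val e ->
    ce (p e).1 (p e).2 = ce x y.
  case: (pP e) => _ ->; rewrite !inE => xy.
  by case/orP=> /eqP xE /orP[]/eqP yE; move: xy; rewrite xE yE ?adj_irrefl.
have end_ (e : edge G) x : x \in val e -> exists2 y, adj x y & val e = [set x; y].
  case: (pP e) => adj_p ->; rewrite !inE => /orP[]/eqP->.
    by exists (p e).2.
  by exists (p e).1; rewrite 1?adj_sym // setUC.
apply/existsP; exists [ffun x => enum_rank (cv x)].
apply/existsP; exists [ffun e => enum_rank (ce (p e).1 (p e).2)].
apply/and3P; split.
- apply/forallP=> x; apply/forallP=> y; apply/implyP=> xy; rewrite !ffunE.
  by rewrite (inj_eq enum_rank_inj) cv_proper.
- apply/forallP=> e; apply/forallP=> f; apply/implyP=> /andP[ef].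
  case/set0Pn=> x /setIP[/end_[y xy eE] /end_[z xz fE]]; rewrite !ffunE.
  rewrite (inj_eq enum_rank_inj); apply: contraNneq ef.
  rewrite (ceP e x y) ?eE ?set21 ?set22 // (ceP f x z) ?fE ?set21 ?set22 //.
  by move/(ce_proper _ _ _ xy xz)=> yz; apply/eqP/val_inj; rewrite eE fE yz.
apply/forallP=> x; apply/forallP=> e; apply/implyP=> /end_[y xy eE].
rewrite !ffunE (inj_eq enum_rank_inj) (ceP e x y) ?eE ?set21 ?set22 //.
exact: cve.
Qed.

(** As 2 is invertible modulo an odd [k], doubling is injective there; this separates the vertex
    colours [i + i] of distinct classes. *)
Lemma modn_double_inj k i j : odd k -> i < k -> j < k ->
  (i + i) %% k = (j + j) %% k -> i = j.
Proof.
move=> k_odd; wlog le_ij : i j / i <= j.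
  by move=> H ik jk ij; case: (leqP i j) => [|/ltnW] /H -> //.
move=> ik jk /esym/eqP; rewrite !addnn eqn_mod_dvd ?leq_double // -doubleB -mul2n.
rewrite Gauss_dvdr ?coprimen2 // => kij; apply/eqP; rewrite eqn_leq le_ij /=.
rewrite -subn_eq0; apply: contraTT kij; rewrite -lt0n => ij0.
by apply/negP=> /(dvdn_leq ij0); rewrite leqNgt (leq_ltn_trans (leq_subr _ _)).
Qed.

(* [K_k] with [k] odd is totally coloured by [i + j mod k], where a vertex is
   treated as a loop; this is lifted along [c] to the matchings between colour
   classes, which lower every degree by [k - 1], and Vizing colours the rest. *)
Lemma total_coloring_equitable (G : sgraph) k (c : G -> 'I_k) q (x0 : G) :
    odd k -> (forall x y, adj x y -> c x != c y) ->
    (forall I : {set G}, independent I -> #|I| <= q) ->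
    (forall i, #|[set x | c x == i]| = q) ->
  total_chromatic_number G <= max_degree G + 2.
Proof.
move=> k_odd c_proper indep_le classq.
have [m [m_sym m_adj m_ex m_uniq]] :=
  color_class_matching c_proper indep_le classq.
have k0 : 0 < k by case: k k_odd {c c_proper classq m_ex m_uniq}.
have m_deg x : k.-1 <= #|[set y | m x y]|.
  rewrite -[k in k.-1]card_ord -(cardC1 (c x)).
  apply: leq_trans (leq_imset_card c _); apply: subset_leq_card.
  apply/subsetP=> i; rewrite inE eq_sym => /m_ex[y <- xy].
  by apply: imset_f; rewrite inE.
have deg (x : G) : #|[set y | adj x y]| <= max_degree G.
  exact: (leq_bigmax x).
pose r x y := adj x y && ~~ m x y.
have r_deg x : #|[set y | m x y]| + #|[set y | r x y]| <= max_degree G.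
  apply: leq_trans (deg x); rewrite -(cardsID [set y | m x y] [set y | adj x y]).
  apply: eq_leq; congr (_ + _); apply: eq_card => y; rewrite !inE.
    by case: (boolP (m x y)) => [/m_adj->|]; rewrite ?andbF.
  by rewrite andbC.
pose C := 'I_(max_degree G + 2 - k).
(* The vertex [x0] yields [k <= max_degree G + 1], so the subtraction in [C] is not truncated and
   the two palettes add up to [max_degree G + 2]. *)
have kD : k.-1 <= max_degree G.
  by apply: leq_trans (m_deg x0) _; apply: leq_trans (leq_addr _ _) (r_deg x0).
have [|||col [col_sym colP]] := @vizing_edge_colors G C r.
- by move=> x y; rewrite /r adj_sym m_sym.
- by move=> x; rewrite /r adj_irrefl.
- by move=> x; rewrite card_ord; have := r_deg x; have := m_deg x; lia.
pose sumc x y := Ordinal (ltn_pmod (c x + c y) k0).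
pose cv x : 'I_k + C := inl (sumc x x).
pose ce x y : 'I_k + C := if m x y then inl (sumc x y) else inr (col x y).
have sumc_inj x y z : sumc x y = sumc x z -> c y = c z.
  move/(congr1 val)/eqP; rewrite /= eqn_modDl !modn_small // => /eqP.
  exact: val_inj.
have -> : max_degree G + 2 = #|{: 'I_k + C}|.
  by rewrite card_sum !card_ord; lia.
apply: (@total_chromatic_number_le G _ cv ce) => [x y|x y xy|x y z xy xz|x y xy].
- rewrite /ce m_sym col_sym; case: ifP => // _; congr inl.
  by apply: val_inj; rewrite /= addnC.
- apply: contraNneq (c_proper _ _ xy) => -[] /modn_double_inj eq_c.
  by apply/eqP/val_inj/eq_c.
- rewrite /ce; case: ifPn => xym; case: ifPn => xzm // [].
    by move=> E; apply: m_uniq xym xzm _; apply/(sumc_inj x)/val_inj.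
  by apply: colP; rewrite /r ?xy ?xz.
rewrite /ce; case: ifP => // _; apply: contraNneq (c_proper _ _ xy) => -[E].
by apply/eqP/(sumc_inj x)/val_inj.
Qed.

(** * Perfect Cayley graphs *)

(** Perfection is applied to the full vertex set. As [induced [set: G]] lives on a subtype, its
    colourings and a maximum clique are carried over to [G]. *)
Lemma perfect_clique (G : sgraph) : perfect G ->
  exists Q : {set G}, {in Q &, forall x y, x != y -> adj x y} /\
    chromatic_number G <= #|Q|.
Proof.
move=> perfG; have := perfG setT.
have le_chi : chromatic_number G <= chromatic_number (induced [set: G]).
  rewrite /chromatic_number; case: ex_minnP => k _; apply.
  case: ex_minnP => l /existsP[c /forallP cP] _.
  apply/existsP; exists [ffun x => c (exist _ x (in_setT x))].
  apply/forallP=> x; apply/forallP=> y; rewrite !ffunE.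
  by have /forallP/(_ (exist _ y (in_setT y))) := cP (exist _ x (in_setT x)).
rewrite /clique_number.
have [|A Acl ->] := @eq_bigmax_cond _ (fun A => clique A)
  (fun A : {set induced [set: G]} => #|A|).
  apply/card_gt0P; exists set0; rewrite unfold_in.
  by apply/forallP=> x; rewrite inE.
move=> chiE; exists [set val x | x in A]; split; last first.
  by rewrite card_imset -?chiE //; apply: val_inj.
move=> _ _ /imsetP[x xA ->] /imsetP[y yA ->] xy.
move/forallP/(_ x)/implyP/(_ xA)/forallP/(_ y)/implyP/(_ yA)/implyP: Acl.
by apply; apply: contraNneq xy => ->.
Qed.

(* The translates of [Q] by [i c^-1] with [i] in [I] and [c] in [Q] are pairwise
   distinct, as each of them meets [I] in a single point. *)
Lemma cayley_clique_coclique (gT : finGroupType) (S : {set gT})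
    (symS : S = (S^-1)%g) (S1 : (1%g : gT) \notin S) (Q I : {set cayley symS S1}) :
    {in Q &, forall x y, x != y -> adj x y} -> independent I ->
  #|I| * #|Q| <= #|gT|.
Proof.
move=> clQ indI; pose d (p : gT * gT) := (p.1 * p.2^-1)%g.
rewrite -cardsX -(card_in_imset (f := d)); first exact: max_card.
move=> [i a] [j b] /setXP[/= iI aQ] /setXP[/= jI bQ]; rewrite /d /= => eq_d.
have [ab|/(clQ _ _ aQ bQ)/exists_inP[s sS /eqP ba]] := eqVneq a b.
  by move: eq_d; rewrite ab => /mulIg->.
(* From [i a^-1 = j b^-1] and [b = a s] follows [j = i s], an edge inside [I]. *)
case/negP: (indI i j iI jI); apply/exists_inP; exists s => //.
by apply/eqP; rewrite -[j](mulgKV b) -eq_d ba mulgA mulgKV.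
Qed.

Theorem theorem2p6 (gT : finGroupType) (S : {set gT})
    (symS : S = (S^-1)%g) (S1 : (1%g : gT) \notin S) :
  perfect (cayley symS S1) ->
  odd (chromatic_number (cayley symS S1)) ->
  (chromatic_number (cayley symS S1) %| #|cayley symS S1|)%N ->
  (total_chromatic_number (cayley symS S1)
     <= max_degree (cayley symS S1) + 2)%N.
Proof.
move=> /perfect_clique[Q [clQ]]; rewrite /chromatic_number.
case: ex_minnP => k /existsP[c /forallP c_proper] _ leQ k_odd k_dvd.
have k0 : 0 < k by case: k k_odd {c c_proper leQ k_dvd}.
have adj_c x y : adj x y -> c x != c y.
  by have /forallP/(_ y)/implyP := c_proper x.
set n := #|cayley symS S1| in k_dvd.
have indep_le (I : {set cayley symS S1}) : independent I -> #|I| <= n %/ k.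
  move=> indI; rewrite leq_divRL //; apply: leq_trans (_ : #|I| * #|Q| <= _).
    by rewrite leq_mul2l leQ orbT.
  exact: cayley_clique_coclique.
have class_le i : #|[set x | c x == i]| <= n %/ k.
  apply: indep_le => x y; rewrite !inE => /eqP xi /eqP yi.
  by apply/negP=> /adj_c; rewrite xi yi eqxx.
pose x0 : cayley symS S1 := (1%g : gT).
refine (total_coloring_equitable x0 k_odd adj_c indep_le _) => i.
(* As [k] divides [n], the [k] class sizes, each at most [n / k], sum to exactly [k (n / k)], which
   forces equality in each. *)
have sum_eq : \sum_i #|[set x | c x == i]| = \sum_(i < k) n %/ k.
  rewrite sum_nat_const card_ord mulnC divnK // /n -sum1_card.
  rewrite (partition_big c predT) //=; apply: eq_bigr => j _.
  by rewrite sum1dep_card; apply: eq_card => x; rewrite !inE.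
have /leqif_sum leS : forall j, true -> #|[set x | c x == j]| <= n %/ k
    ?= iff (#|[set x | c x == j]| == n %/ k) by move=> j _; split.
by move/eqP: sum_eq; rewrite leS => /forallP/(_ i)/eqP.
Qed.
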